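(* Let $A$ be a generic twisted $n$-gon indexed by $\mathbb{Z}$, let $x_j=x_j(A)$ and $y_j=y_j(A)$, and for $k\ge0$ let $x_{j,k}=x_j(T^k(A))$. Then for all $j\in\mathbb{Z}$ and $k\ge 0$, $$x_{j,k}=\begin{cases}x_{j-3k}\left(\prod_{i=-k}^{k-1}y_{j+1+3i}\right)\dfrac{F_{j+2,k-1}F_{j-3,k}}{F_{j-2,k-1}F_{j+1,k}}, & j+k\text{ even},\\[2mm] x_{j+3k}\left(\prod_{i=-k}^{k-1}y_{j+1+3i}\right)\dfrac{F_{j-3,k-1}F_{j+2,k}}{F_{j+1,k-1}F_{j-2,k}}, & j+k\text{ odd},\end{cases}$$ where the $F_{j,k}$ are evaluated at $y_i=y_i(A)$.
   Context: A twisted $n$-gon is a sequence $(A_i)$ of points of the real projective plane, indexed by $\mathbb{Z}$ or by $\frac12+\mathbb{Z}$, with $A_{i+n}=\phi(A_i)$ for a projective transformation $\phi$. The pentagram map gives $B=T(A)$, indexed by the other coset, with $B_i=\overleftrightarrow{A_{i-3/2}A_{i+1/2}}\cap\overleftrightarrow{A_{i-1/2}A_{i+3/2}}$ ($\overleftrightarrow{PQ}$ is the line through $P,Q$); $T^k$ is the $k$-fold iterate. Cross ratio: $\chi(a,b,c,d)=\frac{(a-b)(c-d)}{(a-c)(b-d)}$ for four collinear points (or four concurrent lines). For each index $k$ of a twisted polygon $A$: $x_{2k}(A)=\chi(A_{k-2},A_{k-1},\overleftrightarrow{A_kA_{k+1}}\cap\overleftrightarrow{A_{k-2}A_{k-1}},\overleftrightarrow{A_{k+1}A_{k+2}}\cap\overleftrightarrow{A_{k-2}A_{k-1}})$,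 $x_{2k+1}(A)=\chi(A_{k+2},A_{k+1},\overleftrightarrow{A_kA_{k-1}}\cap\overleftrightarrow{A_{k+2}A_{k+1}},\overleftrightarrow{A_{k-1}A_{k-2}}\cap\overleftrightarrow{A_{k+2}A_{k+1}})$; $y_{2k}(A)=-\big(\chi(\overleftrightarrow{A_kA_{k-2}},\overleftrightarrow{A_kA_{k-1}},\overleftrightarrow{A_kA_{k+1}},\overleftrightarrow{A_kA_{k+2}})\big)^{-1}$, $y_{2k+1}(A)=-\chi(\overleftrightarrow{A_{k-2}A_{k-1}}\cap L,A_k,A_{k+1},\overleftrightarrow{A_{k+2}A_{k+3}}\cap L)$ with $L=\overleftrightarrow{A_kA_{k+1}}$. Generic means all constructions are defined and all quantities finite and nonzero. The functions $F_{j,k}$ ($j\in\mathbb{Z}$, $k\ge-1$) of variables $y_i$ are defined by $F_{j,-1}=F_{j,0}=1$ and, for $k\ge0$, $F_{j,k+1}=\dfrac{F_{j-3,k}F_{j+3,k}+\left(\prod_{i=-k}^{k}y_{j+3i}\right)F_{j-1,k}F_{j+1,k}}{F_{j,k-1}}$. An empty product ($k=0$) equals $1$. *)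

(* Defs.v *)
From HB Require Import structures.
From mathcomp Require Import all_boot all_order all_algebra.
From mathcomp Require Import classical_sets reals.

Set Implicit Arguments.
Unset Strict Implicit.
Unset Printing Implicit Defensive.

Import Order.TTheory GRing.Theory Num.Theory.
Local Open Scope ring_scope.

(* Points and lines of the real projective plane are the subspaces of R^3 of
   dimension 1 and 2. Joins and intersections are total operations on
   subspaces; the predicate [constructible] below says when they are lines
   and points. *)
Notation subspace R := {vspace 'rV[R]_3}.

Section CrossRatio.
Variable R : realType.

Definition line (P Q : subspace R) : subspace R := (P + Q)%VS.
Definition inter (l m : subspace R) : subspace R := (l :&: m)%VS.

Definition chi (a b c d : R) : R := ((a - b) * (c - d)) / ((a - c) * (b - d)).

(* t is an affine coordinate on the projective line spanned by o and v; four
   points of that line are always at finite distance for a suitable choice of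
   (o, v), and the value of chi does not depend on this choice. *)
Definition is_points_cross_ratio (P1 P2 P3 P4 : subspace R) (r : R) : Prop :=
  exists (o v : 'rV[R]_3) (t1 t2 t3 t4 : R),
    [/\ free [:: o; v],
        P1 = <[o + t1 *: v]>%VS /\ P2 = <[o + t2 *: v]>%VS,
        P3 = <[o + t3 *: v]>%VS /\ P4 = <[o + t4 *: v]>%VS
      & r = chi t1 t2 t3 t4].

(* Same for four lines through the point <[c]>, t being an affine coordinate
   on the pencil of lines through <[c]>. *)
Definition is_lines_cross_ratio (l1 l2 l3 l4 : subspace R) (r : R) : Prop :=
  exists (c o v : 'rV[R]_3) (t1 t2 t3 t4 : R),
    [/\ free [:: c; o; v],
        l1 = line <[c]> <[o + t1 *: v]> /\ l2 = line <[c]> <[o + t2 *: v]>,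
        l3 = line <[c]> <[o + t3 *: v]> /\ l4 = line <[c]> <[o + t4 *: v]>
      & r = chi t1 t2 t3 t4].

(* Both functions return 0 if the cross ratio is not defined or is infinite
   (in a field, z / 0 = 0), so "finite and nonzero" reads "!= 0". *)
Definition points_cross_ratio (P1 P2 P3 P4 : subspace R) : R :=
  xget 0 [set r | is_points_cross_ratio P1 P2 P3 P4 r]%classic.

Definition lines_cross_ratio (l1 l2 l3 l4 : subspace R) : R :=
  xget 0 [set r | is_lines_cross_ratio l1 l2 l3 l4 r]%classic.

End CrossRatio.

(* A sequence indexed by Z (half_indexed = false) or by 1/2 + Z (half_indexed =
   true). Indices are doubled: vertex A d is the point A_{d/2}, and it is
   meaningful only if the parity of d is that of the doubled index set. *)
Record polygon (R : realType) := Polygon {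
  half_indexed : bool;
  vertex : int -> subspace R
}.

Section Pentagram.
Variable R : realType.
Implicit Types (A : polygon R) (d j : int).

Definition is_index A d : bool := odd `|d|%N == half_indexed A.

Definition twisted_ngon (n : nat) A : Prop :=
  (forall d, is_index A d -> \dim (vertex A d) = 1%N) /\
  exists phi : 'End('rV[R]_3),
    lker phi = 0%VS /\
    forall d, is_index A d ->
      vertex A (d + 2 * n%:Z) = (phi @: vertex A d)%VS.

Definition pentagram A : polygon R :=
  Polygon (~~ half_indexed A) (fun d =>
    inter (line (vertex A (d - 3)) (vertex A (d + 1)))
          (line (vertex A (d - 1)) (vertex A (d + 3)))).

(* If j = 2k for an index k of A, then A_{k+m} is vertex A (j + 2m); otherwise
   j = 2k+1 for an index k of A, and A_{k+m} is vertex A (d + 2m), d = j - 1. *)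
Definition xcoord A j : R :=
  let a := vertex A in
  if is_index A j then
    let L := line (a (j - 4)) (a (j - 2)) in
    points_cross_ratio (a (j - 4)) (a (j - 2))
      (inter (line (a j) (a (j + 2))) L)
      (inter (line (a (j + 2)) (a (j + 4))) L)
  else
    let d := j - 1 in
    let L := line (a (d + 4)) (a (d + 2)) in
    points_cross_ratio (a (d + 4)) (a (d + 2))
      (inter (line (a d) (a (d - 2))) L)
      (inter (line (a (d - 2)) (a (d - 4))) L).

Definition ycoord A j : R :=
  let a := vertex A in
  if is_index A j then
    - (lines_cross_ratio (line (a j) (a (j - 4))) (line (a j) (a (j - 2)))
                         (line (a j) (a (j + 2))) (line (a j) (a (j + 4))))^-1
  else
    let d := j - 1 in
    let L := line (a d) (a (d + 2)) in
    - points_cross_ratio (inter (line (a (d - 4)) (a (d - 2))) L)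
        (a d) (a (d + 2))
        (inter (line (a (d + 4)) (a (d + 6))) L).

(* All the joins and intersections occurring in [pentagram], [xcoord] and
   [ycoord] are lines and points. *)
Definition constructible A : Prop :=
  let a := vertex A in
  forall d, is_index A d ->
    [/\ \dim (a d) = 1%N,
        \dim (line (a d) (a (d + 2))) = 2%N /\
        \dim (line (a d) (a (d + 4))) = 2%N,
        \dim (inter (line (a d) (a (d + 4))) (line (a (d + 2)) (a (d + 6)))) = 1%N,
        \dim (inter (line (a d) (a (d + 2))) (line (a (d + 4)) (a (d + 6)))) = 1%N
      & \dim (inter (line (a d) (a (d + 2))) (line (a (d + 6)) (a (d + 8)))) = 1%N].

Definition generic A : Prop :=
  forall k : nat,
    constructible (iter k pentagram A) /\
    forall j, xcoord (iter k pentagram A) j != 0 /\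
              ycoord (iter k pentagram A) j != 0.

End Pentagram.

(* Fshift y m j is F_{j,m-1} evaluated at y. *)
Fixpoint Fshift (R : fieldType) (y : int -> R) (m : nat) (j : int) : R :=
  match m with
  | m'.+1 =>
    match m' with
    | k.+1 =>
      (Fshift y m' (j - 3) * Fshift y m' (j + 3)
       + (\prod_(0 <= i < (2 * k).+1) y (j + 3 * (i%:Z - k%:Z)))
         * Fshift y m' (j - 1) * Fshift y m' (j + 1))
      / Fshift y k j
    | 0 => 1
    end
  | 0 => 1
  end.

(* F_{j,k}, meaningful for k >= -1. *)
Definition F (R : fieldType) (y : int -> R) (j k : int) : R :=
  Fshift y (absz (k + 1)) j.

(* Main.v *)
Require Import Defs.
From HB Require Import structures.
From mathcomp Require Import all_boot all_order all_algebra.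
From mathcomp Require Import boolp classical_sets reals.
From mathcomp Require Import ring lra zify.

Import Order.TTheory GRing.Theory Num.Theory.
Local Open Scope ring_scope.

(* Lift the vertices of a polygon to vectors of R^3. Every coordinate x_j, y_j,
   and 1 + y_j when j/2 is an index, is then a monomial in the determinants
   (i, i+1, i+2), (i, i+1, i+3), (i, i+2, i+3) and (i, i+2, i+4) of the lifted
   vertices, and the first three kinds of determinants of the pentagram image
   are monomials in those of the polygon. Hence one step of the pentagram map
   acts on the coordinates by explicit rational formulas. Iterating them gives,
   for j + k even, with M_{j,k} the product of the y_{j+3i} for |i| <= k,
     y_j(T^k A)     = M_{j,k} F_{j-1,k} F_{j+1,k} / (F_{j-3,k} F_{j+3,k}),
     1 + y_j(T^k A) = F_{j,k+1} F_{j,k-1} / (F_{j-3,k} F_{j+3,k}),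
   and the formula for x follows by telescoping. Genericity makes 1 + y_j(T^k A)
   nonzero for j + k even, so F_{j,k} is nonzero whenever j + k is odd, and only
   these F occur. *)

(** * The recurrence *)

Section Recurrence.
Variables (K : fieldType) (y : int -> K).
Hypothesis y_neq0 : forall j, y j != 0.

(** * Products of the y over arithmetic progressions of step 3 *)

Definition prog_prod (j : int) (m : nat) : K :=
  \prod_(0 <= i < m) y (j + 3 * i%:Z).

Lemma prog_prodSr j m : prog_prod j m.+1 = prog_prod j m * y (j + 3 * m%:Z).
Proof. by rewrite /prog_prod big_nat_recr. Qed.

Lemma prog_prodSl j m : prog_prod j m.+1 = y j * prog_prod (j + 3) m.
Proof.
rewrite /prog_prod big_nat_recl // mulr0 addr0; congr (_ * _).
by apply: eq_bigr => i _; congr y; lia.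
Qed.

(* [odd_prod k.+1 j] is M_{j,k}; the value at [0] extends the recurrence
   M_{j-3,k} M_{j+3,k} = M_{j,k+1} M_{j,k-1} to k = 0. *)
Definition odd_prod (m : nat) (j : int) : K :=
  if m is k.+1 then prog_prod (j - 3 * k%:Z) (2 * k).+1 else (y j)^-1.

(** The product over $-k\le i\le k-1$ in the theorem is [even_prod k (j + 1)]. *)
Definition even_prod (k : nat) (j : int) : K := prog_prod (j - 3 * k%:Z) (2 * k).

Lemma prog_prod_neq0 j m : prog_prod j m != 0.
Proof. by rewrite /prog_prod prodf_seq_neq0; apply/allP => i _; exact: y_neq0. Qed.

Lemma odd_prod_neq0 m j : odd_prod m j != 0.
Proof. by case: m => [|m] /=; rewrite ?invr_eq0 ?y_neq0 ?prog_prod_neq0. Qed.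

(** The two progressions on the left overlap: their union and their intersection are the
    progressions on the right. For [k = 0] they are disjoint and leave a gap at [j], which the value
    [(y j)^-1] of [odd_prod 0 j] compensates. *)
Lemma odd_prod_recur k j :
  odd_prod k.+1 (j - 3) * odd_prod k.+1 (j + 3) = odd_prod k.+2 j * odd_prod k j.
Proof.
case: k => [|k] /=.
  rewrite !mulr0 !muln0 !muln1 !subr0 !prog_prodSr /prog_prod !big_nil.
  rewrite !mul1r !mulr0 !addr0 mulr1.
  rewrite (_ : j - 3 + 3 * 1 = j); last by lia.
  rewrite (_ : j - 3 + 3 * 2 = j + 3); last by lia.
  by field.
rewrite (_ : 2 * k.+2 = (2 * k.+1).+2)%N; last by lia.
rewrite (_ : 2 * k.+1 = (2 * k).+2)%N; last by lia.
rewrite [prog_prod (j - 3 * k.+2%:Z) _]prog_prodSr.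
rewrite [prog_prod (j - 3 * k.+2%:Z) _]prog_prodSr.
rewrite [prog_prod (j + 3 - _) _]prog_prodSr.
rewrite [prog_prod (j + 3 - _) _]prog_prodSr.
rewrite (_ : j + 3 - 3 * k.+1%:Z = j - 3 * k%:Z); last by lia.
rewrite (_ : j - 3 - 3 * k.+1%:Z = j - 3 * k.+2%:Z); last by lia.
rewrite -(_ : j - 3 * k%:Z + 3 * (2 * k).+1%:Z = j - 3 * k.+2%:Z + 3 * (2 * k).+3%:Z);
  last by lia.
rewrite -(_ : j - 3 * k%:Z + 3 * (2 * k).+2%:Z = j - 3 * k.+2%:Z + 3 * (2 * k).+4%:Z);
  last by lia.
by ring.
Qed.

(** Again union times intersection of two progressions, here extending the product downwards;
    [even_prod_recurr] extends it upwards. These are the changes of the y-product in the two cases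
    of the theorem when $k$ grows by one. *)
Lemma even_prod_recurl k j :
  even_prod k (j - 3) * odd_prod k.+1 j = even_prod k.+1 j * odd_prod k (j - 3).
Proof.
rewrite /even_prod; case: k => [|k] /=.
  rewrite !mulr0 !muln0 !muln1 !subr0 !prog_prodSr /prog_prod !big_nil.
  rewrite !mul1r !mulr0 !addr0 mulr1 mulrAC mulfV ?y_neq0 // mul1r.
  by congr y; lia.
rewrite (_ : j - 3 - 3 * k.+1%:Z = j - 3 * k.+2%:Z); last by lia.
rewrite (_ : 2 * k.+2 = (2 * k).+4)%N; last by lia.
rewrite (_ : 2 * k.+1 = (2 * k).+2)%N; last by lia.
rewrite prog_prodSl [prog_prod (j - 3 * k.+2%:Z) _]prog_prodSl.
rewrite (_ : j - 3 * k.+2%:Z + 3 = j - 3 * k.+1%:Z); last by lia.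
rewrite (_ : j - 3 - 3 * k%:Z = j - 3 * k.+1%:Z); last by lia.
by ring.
Qed.

Lemma even_prod_recurr k j :
  even_prod k (j + 3) * odd_prod k.+1 (j - 3) = even_prod k.+1 j * odd_prod k j.
Proof.
rewrite /even_prod; case: k => [|k] /=.
  rewrite !mulr0 !muln0 !muln1 !subr0 !prog_prodSr /prog_prod !big_nil.
  rewrite !mul1r !mulr0 !addr0 mulr1 (_ : j - 3 + 3 * 1 = j); last by lia.
  by rewrite mulfK ?y_neq0.
rewrite (_ : j + 3 - 3 * k.+1%:Z = j - 3 * k%:Z); last by lia.
rewrite (_ : j - 3 - 3 * k.+1%:Z = j - 3 * k.+2%:Z); last by lia.
rewrite (_ : 2 * k.+2 = (2 * k).+4)%N; last by lia.
rewrite (_ : 2 * k.+1 = (2 * k).+2)%N; last by lia.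
rewrite prog_prodSr [prog_prod (j - 3 * k.+2%:Z) _.+4]prog_prodSr.
rewrite (_ : j - 3 * k.+2%:Z + 3 * (2 * k).+3%:Z = j - 3 * k%:Z + 3 * (2 * k).+1%:Z);
  last by lia.
by ring.
Qed.

Local Notation f := (Fshift y).

Lemma FshiftSS k j : f k.+2 j =
  (f k.+1 (j - 3) * f k.+1 (j + 3)
   + odd_prod k.+1 j * f k.+1 (j - 1) * f k.+1 (j + 1)) / f k j.
Proof.
have -> : odd_prod k.+1 j = \prod_(0 <= i < (2 * k).+1) y (j + 3 * (i%:Z - k%:Z)).
  by rewrite /odd_prod /prog_prod; apply: eq_bigr => i _; congr y; lia.
by [].
Qed.

(** * Iteration of the coordinate formulas, independently of the geometry *)

Variables X Y : nat -> int -> K.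
Hypothesis Y0 : forall j, Y 0 j = y j.
Hypothesis Y1_neq0 : forall k j, ~~ odd (absz (j + k%:Z)) -> 1 + Y k j != 0.
(** For [X k], [Y k] read as the coordinates of $T^k(A)$, $j+k$ is even exactly when $j/2$ is an
    index of $T^k(A)$. The suffixes [_even] and [_odd] refer to the parity of $j+k+1$, that is, to
    the image polygon. *)
Hypothesis Y_even : forall k j, odd (absz (j + k%:Z)) ->
  Y k.+1 j = Y k (j - 3) * Y k j * Y k (j + 3)
    * ((1 + Y k (j - 1)) * (1 + Y k (j + 1)))
    / ((1 + Y k (j - 3)) * (1 + Y k (j + 3))).
Hypothesis Y_odd : forall k j, ~~ odd (absz (j + k%:Z)) -> Y k.+1 j = (Y k j)^-1.
Hypothesis X_even : forall k j, odd (absz (j + k%:Z)) ->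
  X k.+1 j = X k (j - 3) * (Y k (j - 2) * Y k (j + 1))
    * ((1 + Y k (j - 3)) / (1 + Y k (j + 1))).
Hypothesis X_odd : forall k j, ~~ odd (absz (j + k%:Z)) ->
  X k.+1 j = X k (j + 3) * (Y k (j - 2) * Y k (j + 1))
    * ((1 + Y k (j + 2)) / (1 + Y k (j - 2))).

(** The five claims need a joint induction: the formula for [1 + Y k j] gives the nonvanishing of
    the next F, and this permits the divisions at the next level. Recall that [f k.+1] is
    $F_{\cdot,k}$. *)
Lemma Y_closed_form k :
  [/\ forall j, ~~ odd (absz (j + k%:Z)) -> f k j != 0,
      forall j, odd (absz (j + k%:Z)) -> f k.+1 j != 0,
      forall j, ~~ odd (absz (j + k%:Z)) ->
        Y k j = odd_prod k.+1 j * f k.+1 (j - 1) * f k.+1 (j + 1)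
                / (f k.+1 (j - 3) * f k.+1 (j + 3)),
      forall j, odd (absz (j + k%:Z)) ->
        Y k j = f k (j - 3) * f k (j + 3)
                / (odd_prod k j * f k (j - 1) * f k (j + 1))
    & forall j, ~~ odd (absz (j + k%:Z)) ->
        1 + Y k j = f k.+2 j * f k j / (f k.+1 (j - 3) * f k.+1 (j + 3))].
Proof.
(* Over the common denominator, adding 1 to the formula for [Y k' j] produces the numerator in the
   recurrence for F; hence the last claim follows from earlier ones at the same level. *)
have step k' : (forall j, ~~ odd (absz (j + k'%:Z)) -> f k' j != 0) ->
    (forall j, odd (absz (j + k'%:Z)) -> f k'.+1 j != 0) ->
    (forall j, ~~ odd (absz (j + k'%:Z)) ->
      Y k' j = odd_prod k'.+1 j * f k'.+1 (j - 1) * f k'.+1 (j + 1)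
              / (f k'.+1 (j - 3) * f k'.+1 (j + 3))) ->
    forall j, ~~ odd (absz (j + k'%:Z)) ->
      1 + Y k' j = f k'.+2 j * f k' j / (f k'.+1 (j - 3) * f k'.+1 (j + 3)).
  move=> f_neq0 f1_neq0 YE j j_even; rewrite YE // FshiftSS divfK ?f_neq0 //.
  have fm : f k'.+1 (j - 3) != 0 by apply: f1_neq0; lia.
  have fp : f k'.+1 (j + 3) != 0 by apply: f1_neq0; lia.
  by rewrite mulrDl mulfV ?mulf_neq0.
elim: k => [|k [f_neq0 f1_neq0 Ye Yo Y1]].
  have Ye j : Y 0 j = odd_prod 1 j * f 1 (j - 1) * f 1 (j + 1)
              / (f 1 (j - 3) * f 1 (j + 3)).
    by rewrite /= Y0 mulr0 subr0 muln0 /prog_prod big_nat1 mulr0 addr0 !mulr1 divr1.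
  split=> [j _|j _|j _|j _|]; rewrite ?Ye ?oner_eq0 //.
    by rewrite -Ye /= !mulr1 !mul1r invrK Y0.
  by apply: step => j _; rewrite ?oner_eq0 ?Ye.
(* The value [f k.+2 j] is a factor of [1 + Y k j], which is nonzero by hypothesis. *)
have f2_neq0 j : odd (absz (j + k.+1%:Z)) -> f k.+2 j != 0.
  move=> j_odd; have jk : ~~ odd (absz (j + k%:Z)) by lia.
  by apply: contraNneq (Y1_neq0 _ _ jk) => fj; rewrite Y1 // fj !mul0r.
have f1_neq0' j : ~~ odd (absz (j + k.+1%:Z)) -> f k.+1 j != 0.
  by move=> j_even; apply: f1_neq0; lia.
have Ye' j : ~~ odd (absz (j + k.+1%:Z)) ->
    Y k.+1 j = odd_prod k.+2 j * f k.+2 (j - 1) * f k.+2 (j + 1)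
              / (f k.+2 (j - 3) * f k.+2 (j + 3)).
  move=> jk; rewrite Y_even; last by lia.
  rewrite !Y1 ?(Ye (_ - _)) ?(Ye (_ + _)) ?Yo; try lia.
  have rec := odd_prod_recur k j.
  (* Now both sides involve the same products, and once the indices are normalised [field] can treat
     every product and every F as an atom. *)
  have -> : odd_prod k.+2 j
      = odd_prod k.+1 (j - 3) * odd_prod k.+1 (j + 3) / odd_prod k j.
    by rewrite rec mulfK ?odd_prod_neq0.
  have e1 : j - 3 - 1 = j - 1 - 3 by lia.
  have e2 : j - 3 + 1 = j + 1 - 3 by lia.
  have e3 : j + 3 - 1 = j - 1 + 3 by lia.
  have e4 : j + 3 + 1 = j + 1 + 3 by lia.
  have e5 : j + 3 - 3 = j by lia.
  have e6 : j - 3 + 3 = j by lia.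
  rewrite e1 e2 e3 e4 e5 e6.
  field; rewrite ?odd_prod_neq0 ?f2_neq0 ?f1_neq0 ?f_neq0 //; lia.
split=> //; last exact: step.
move=> j jk; have jk' : ~~ odd (absz (j + k%:Z)) by lia.
by rewrite Y_odd // Ye // invf_div.
Qed.

(** In each case one of the two factors Y contributes an $M_{\cdot,k}$ and the other the inverse of
    an $M_{\cdot,k-1}$; [even_prod_recurl] and [even_prod_recurr] absorb them into the longer
    product, and the surplus F cancel. *)
Lemma X_closed_form k :
  (forall j, ~~ odd (absz (j + k%:Z)) ->
     X k j = X 0 (j - 3 * k%:Z) * even_prod k (j + 1)
       * ((f k (j + 2) * f k.+1 (j - 3)) / (f k (j - 2) * f k.+1 (j + 1))))
  /\ (forall j, odd (absz (j + k%:Z)) ->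
     X k j = X 0 (j + 3 * k%:Z) * even_prod k (j + 1)
       * ((f k (j - 3) * f k.+1 (j + 2)) / (f k (j + 1) * f k.+1 (j - 2)))).
Proof.
elim: k => [|k [IHe IHo]].
  by split=> j _; rewrite /even_prod /prog_prod mulr0 ?subr0 ?addr0 muln0
    big_nil /= !mulr1 divr1 mulr1.
have [f_neq0 f1_neq0 Ye Yo Y1] := Y_closed_form k.
(* The denominators [1 + Y k (j + 1)] and [1 + Y k (j - 2)] contain $F_{\cdot,k+1}$, so nonvanishing
   is needed one level higher. *)
have [_ f2_neq0 _ _ _] := Y_closed_form k.+1.
split=> j jk.
  rewrite X_even; last by lia.
  rewrite IHe ?Y1 ?(Ye (j + 1)) ?(Yo (j - 2)); try lia.
  rewrite (_ : j - 3 - 3 * k%:Z = j - 3 * k.+1%:Z); last by lia.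
  have -> : even_prod k.+1 (j + 1)
      = even_prod k (j + 1 - 3) * odd_prod k.+1 (j + 1) / odd_prod k (j + 1 - 3).
    by rewrite even_prod_recurl mulfK ?odd_prod_neq0.
  have e1 : j - 3 + 1 = j - 2 by lia.
  have e2 : j + 1 - 3 = j - 2 by lia.
  have e3 : j - 3 + 2 = j - 1 by lia.
  have e4 : j - 3 - 3 = j - 6 by lia.
  have e5 : j - 3 - 2 = j - 5 by lia.
  have e6 : j - 2 - 3 = j - 5 by lia.
  have e7 : j - 2 + 3 = j + 1 by lia.
  have e8 : j - 2 - 1 = j - 3 by lia.
  have e9 : j - 2 + 1 = j - 1 by lia.
  have e10 : j + 1 - 1 = j by lia.
  have e11 : j + 1 + 1 = j + 2 by lia.
  have e12 : j + 1 + 3 = j + 4 by lia.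
  have e13 : j - 3 + 3 = j by lia.
  rewrite e1 e2 e3 e4 e5 e6 e7 e8 e9 e10 e11 e12 e13.
  field; rewrite ?odd_prod_neq0 ?f2_neq0 ?f1_neq0 ?f_neq0 //; lia.
rewrite X_odd; last by lia.
rewrite IHo ?Y1 ?(Ye (j - 2)) ?(Yo (j + 1)); try lia.
rewrite (_ : j + 3 + 3 * k%:Z = j + 3 * k.+1%:Z); last by lia.
have -> : even_prod k.+1 (j + 1)
    = even_prod k (j + 1 + 3) * odd_prod k.+1 (j + 1 - 3) / odd_prod k (j + 1).
  by rewrite even_prod_recurr mulfK ?odd_prod_neq0.
have e1 : j + 1 + 3 = j + 4 by lia.
have e2 : j + 1 - 3 = j - 2 by lia.
have e3 : j + 3 + 1 = j + 4 by lia.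
have e4 : j + 3 - 3 = j by lia.
have e5 : j + 3 + 2 = j + 5 by lia.
have e6 : j + 3 - 2 = j + 1 by lia.
have e7 : j - 2 - 1 = j - 3 by lia.
have e8 : j - 2 + 1 = j - 1 by lia.
have e9 : j - 2 - 3 = j - 5 by lia.
have e10 : j - 2 + 3 = j + 1 by lia.
have e11 : j + 1 - 1 = j by lia.
have e12 : j + 1 + 1 = j + 2 by lia.
have e13 : j + 2 - 3 = j - 1 by lia.
have e14 : j + 2 + 3 = j + 5 by lia.
rewrite e1 e2 e3 e4 e5 e6 e7 e8 e9 e10 e11 e12 e13 e14.
field; rewrite ?odd_prod_neq0 ?f2_neq0 ?f1_neq0 ?f_neq0 //; lia.
Qed.

End Recurrence.

(** * Determinants and cross ratios *)

Section Bracket.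
Variable R : realType.
Implicit Types (p q r s u v w : 'rV[R]_3) (c d : R).

(** The determinant of the rows [p], [q], [r], expanded in coordinates so that [ring] can decide
    identities between brackets. *)
Definition bracket p q r : R :=
  let x u := u ord0 ord0 in
  let y u := u ord0 (inord 1) in
  let z u := u ord0 (inord 2) in
  x p * (y q * z r - z q * y r) - y p * (x q * z r - z q * x r)
  + z p * (x q * y r - y q * x r).

Lemma bracket_lin3 c d p q r s :
  bracket p q (c *: r + d *: s) = c * bracket p q r + d * bracket p q s.
Proof. rewrite /bracket !mxE; ring. Qed.

Lemma bracket_cycle p q r : bracket p q r = bracket q r p.
Proof. rewrite /bracket; ring. Qed.

Lemma bracket_swap p q r : bracket q p r = - bracket p q r.
Proof. rewrite /bracket; ring. Qed.

Lemma bracket_lin2 c d p q r s :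
  bracket p (c *: r + d *: s) q = c * bracket p r q + d * bracket p s q.
Proof. rewrite /bracket !mxE; ring. Qed.

Lemma bracket_lin1 c d p q r s :
  bracket (c *: r + d *: s) p q = c * bracket r p q + d * bracket s p q.
Proof. rewrite /bracket !mxE; ring. Qed.

Lemma bracketxx p q : [/\ bracket p p q = 0, bracket p q p = 0 & bracket q p p = 0].
Proof. by split; rewrite /bracket; ring. Qed.

Lemma row3P p q : p ord0 ord0 = q ord0 ord0 ->
  p ord0 (inord 1) = q ord0 (inord 1) ->
  p ord0 (inord 2) = q ord0 (inord 2) -> p = q.
Proof.
move=> e0 e1 e2; apply/rowP => -[[|[|[|//]]] im]; rewrite ?ord1.
- by have -> : Ordinal im = ord0 by apply: val_inj.
- by have -> : Ordinal im = inord 1 by apply: val_inj; rewrite /= inordK.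
- by have -> : Ordinal im = inord 2 by apply: val_inj; rewrite /= inordK.
Qed.

(** Cramer's rule: the linear relation among four vectors of a space of dimension 3. *)
Lemma bracket_cramer p q r s :
  bracket q r s *: p + bracket p q s *: r = bracket p r s *: q + bracket p q r *: s.
Proof. by apply: row3P; rewrite /bracket !mxE; ring. Qed.

(** The three-term Grassmann-Plücker relation for brackets sharing [w]. *)
Lemma bracket_plucker w p q r s :
  bracket p q w * bracket w r s + bracket p w s * bracket q w r
  = bracket p w r * bracket q w s.
Proof. rewrite /bracket; ring. Qed.

Lemma in_line p q u :
  reflect (exists c d, u = c *: p + d *: q) (u \in line <[p]> <[q]>).
Proof.
apply: (iffP memv_addP) => [[_ /vlineP[c ->] [_ /vlineP[d ->] ->]]|[c [d ->]]].
  by exists c, d.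
by exists (c *: p); rewrite ?memvZ ?memv_line //; exists (d *: q);
  rewrite ?memvZ ?memv_line.
Qed.


(** Bracketing with the unit vectors gives, up to sign, the 2 by 2 minors of [p] and [q]; if all of
    them vanish, the two vectors are proportional. *)
Lemma free2_bracket p q : free [:: p; q] -> exists w, bracket p q w != 0.
Proof.
rewrite free_cons seq1_free span_seq1 => /andP[p_notin q_neq0].
apply: contrapT => /forallNP bracket0.
have b0 w : bracket p q w = 0 by have /negP := bracket0 w; rewrite negbK => /eqP.
pose e k : 'rV[R]_3 := delta_mx ord0 k.
have := (b0 (e ord0), b0 (e (inord 1)), b0 (e (inord 2))).
rewrite /bracket !mxE !eqxx /= -!val_eqE /= !inordK //= => -[[m0 m1] m2].
have pq i : q ord0 i *: p = p ord0 i *: q.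
  have : [\/ i = ord0, i = inord 1 | i = inord 2].
    case: i => -[|[|[|//]]] im; [apply: Or31 | apply: Or32 | apply: Or33];
      by apply: val_inj; rewrite /= ?inordK.
  by case=> ->; apply: row3P; rewrite !mxE; lra.
have [i qi_neq0] : exists i, q ord0 i != 0.
  by apply/rV0Pn.
move/negP: p_notin; apply; apply/vlineP; exists (p ord0 i / q ord0 i).
by rewrite mulrC -scalerA -pq scalerA mulVf // scale1r.
Qed.

Lemma bracket_eq0_in_line p q r :
  free [:: p; q] -> bracket p q r = 0 -> r \in line <[p]> <[q]>.
Proof.
move=> /free2_bracket[w pqw] pqr; apply/in_line.
exists (- bracket q r w / bracket p q w), (bracket p r w / bracket p q w).
apply: (scalerI pqw); have := bracket_cramer p q r w; rewrite pqr scale0r addr0.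
rewrite scalerDr !scalerA ![_ * (_ / _)]mulrC !divfK // scaleNr => <-.
by rewrite addrA addNr add0r.
Qed.

Lemma free3_bracket_neq0 p q r : free [:: p; q; r] -> bracket p q r != 0.
Proof.
have -> : free [:: p; q; r] = free [:: r; p; q].
  by apply: perm_free; rewrite -(perm_rot 2).
rewrite free_cons => /andP[r_notin pq_free]; apply: contraNneq r_notin.
by rewrite span_cons span_seq1; apply: bracket_eq0_in_line.
Qed.

(** The right-hand vector is the combination of [p] and [q] whose bracket with [r] and [s] vanishes;
    Cramer's rule also writes it as a combination of [r] and [s]. Conversely, bracketing a common
    vector with [r] and [s] fixes the ratio of its coefficients on [p] and [q]. *)
Lemma inter_line p q r s :
  (exists w, bracket p q w != 0) -> (bracket p r s != 0) || (bracket q r s != 0) ->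
  inter (line <[p]> <[q]>) (line <[r]> <[s]>)
  = <[bracket p r s *: q - bracket q r s *: p]>%VS.
Proof.
move=> [w pqw] prs_qrs; apply/eqP; rewrite eqEsubv; apply/andP; split; last first.
  rewrite /inter subv_cap; apply/andP; split; rewrite -memvE; apply/in_line.
    by exists (- bracket q r s), (bracket p r s); rewrite addrC scaleNr.
  exists (bracket p q s), (- bracket p q r).
  by apply: row3P; rewrite /bracket !mxE; ring.
apply/subvP => u; rewrite memv_cap => /andP[/in_line[c [d ->]] /in_line[c' [d' e]]].
have := congr1 (fun u => bracket u r s) e.
rewrite !bracket_lin1; have [-> _ _] := bracketxx r s.
have [_ -> _] := bracketxx s r; rewrite !mulr0 addr0 => cd0; apply/vlineP.
case/orP: prs_qrs => nz.
  have -> : c = - (d * bracket q r s / bracket p r s).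
    by apply: (mulIf nz); rewrite mulNr divfK //; lra.
  by exists (d / bracket p r s); apply: row3P; rewrite !mxE; field.
have -> : d = - (c * bracket p r s / bracket q r s).
  by apply: (mulIf nz); rewrite mulNr divfK //; lra.
by exists (- c / bracket q r s); apply: row3P; rewrite !mxE; field.
Qed.

(** * Cross ratios as ratios of determinants *)

Lemma vline_eq_scale u p : u != 0 -> <[u]>%VS = <[p]>%VS ->
  exists2 c, c != 0 & u = c *: p.
Proof.
move=> u_neq0 e; have /vlineP[c uE] : u \in <[p]>%VS by rewrite -e memv_line.
by exists c => //; apply: contraNneq u_neq0 => c0; rewrite uE c0 scale0r.
Qed.

(** The cross ratio of the four points as seen from [w], that is, of the lines joining [w] to
    them. *)
Definition bracket_chi w p1 p2 p3 p4 : R :=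
  (bracket w p1 p2 * bracket w p3 p4) / (bracket w p1 p3 * bracket w p2 p4).

Lemma bracket_affine w o v (t1 t2 : R) :
  bracket w (o + t1 *: v) (o + t2 *: v) = (t2 - t1) * bracket w o v.
Proof. rewrite /bracket !mxE; ring. Qed.

(* In [chi t1 t2 t3 t4] and in [bracket_chi w p1 p2 p3 p4] every index occurs
   once above and once below, so rescaling the points does not matter. *)
Lemma chi_bracket w o v (t1 t2 t3 t4 c1 c2 c3 c4 : R) p1 p2 p3 p4 :
  c1 != 0 -> c2 != 0 -> c3 != 0 -> c4 != 0 -> bracket w o v != 0 ->
  bracket w (o + t1 *: v) (o + t2 *: v) = c1 * c2 * bracket w p1 p2 ->
  bracket w (o + t3 *: v) (o + t4 *: v) = c3 * c4 * bracket w p3 p4 ->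
  bracket w (o + t1 *: v) (o + t3 *: v) = c1 * c3 * bracket w p1 p3 ->
  bracket w (o + t2 *: v) (o + t4 *: v) = c2 * c4 * bracket w p2 p4 ->
  chi t1 t2 t3 t4 = bracket_chi w p1 p2 p3 p4.
Proof.
move=> c1n c2n c3n c4n D e12 e34 e13 e24; rewrite /chi /bracket_chi.
have e (t t' c c' : R) p p' : c != 0 -> c' != 0 ->
    bracket w (o + t *: v) (o + t' *: v) = c * c' * bracket w p p' ->
    bracket w p p' = (t' - t) * bracket w o v / (c * c').
  by move=> cn cn'; rewrite bracket_affine => ->;
    rewrite mulrAC mulfV ?mul1r ?mulf_neq0.
rewrite (e _ _ _ _ _ _ c1n c2n e12) (e _ _ _ _ _ _ c3n c4n e34).
rewrite (e _ _ _ _ _ _ c1n c3n e13) (e _ _ _ _ _ _ c2n c4n e24).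
(* If a denominator vanishes, both sides are 0 because division by zero gives 0. *)
have [->|t13] := eqVneq t1 t3; first by rewrite !subrr !mul0r !invr0 !mulr0.
have [->|t24] := eqVneq t2 t4; first by rewrite !subrr !(mul0r, mulr0, invr0).
field; rewrite ?c1n ?c2n ?c3n ?c4n ?D ?subr_eq0 ?[t3 == _]eq_sym
  ?[t4 == _]eq_sym ?t13 ?t24 //.
Qed.

(** A nonzero value cannot be the default of [xget], so affine coordinates exist. The condition on
    [w] puts it off the line of the four points. *)
Lemma points_cross_ratioE w p1 p2 p3 p4 :
  points_cross_ratio <[p1]> <[p2]> <[p3]> <[p4]> != 0 -> bracket w p1 p2 != 0 ->
  points_cross_ratio <[p1]> <[p2]> <[p3]> <[p4]> = bracket_chi w p1 p2 p3 p4.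
Proof.
rewrite /points_cross_ratio; case: xgetP => [_ -> [o [v [t1 [t2 [t3 [t4]]]]]]|];
  last by rewrite eqxx.
move=> [ov [e1 e2] [e3 e4] ->] _ w12.
have nz t : o + t *: v != 0.
  move: ov; rewrite free_cons => /andP[o_notin _]; apply: contraNneq o_notin => ot.
  rewrite span_seq1; apply/vlineP; exists (- t).
  by rewrite scaleNr; apply/eqP; rewrite -addr_eq0 ot.
have [c1 c1n o1] := vline_eq_scale _ _ (nz t1) (esym e1).
have [c2 c2n o2] := vline_eq_scale _ _ (nz t2) (esym e2).
have [c3 c3n o3] := vline_eq_scale _ _ (nz t3) (esym e3).
have [c4 c4n o4] := vline_eq_scale _ _ (nz t4) (esym e4).
have brZ (c c' : R) p p' : bracket w (c *: p) (c' *: p') = c * c' * bracket w p p'.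
  by rewrite /bracket !mxE; ring.
have D : bracket w o v != 0.
  have : bracket w (o + t1 *: v) (o + t2 *: v) != 0 by rewrite o1 o2 brZ !mulf_neq0.
  by rewrite bracket_affine mulf_eq0 negb_or => /andP[].
by apply: (chi_bracket _ o v _ _ _ _ c1 c2 c3 c4); rewrite // ?o1 ?o2 ?o3 ?o4 brZ.
Qed.

Lemma lines_cross_ratioE a p1 p2 p3 p4 :
  let r := lines_cross_ratio (line <[a]> <[p1]>) (line <[a]> <[p2]>)
                             (line <[a]> <[p3]>) (line <[a]> <[p4]>) in
  a != 0 -> r != 0 -> r = bracket_chi a p1 p2 p3 p4.
Proof.
rewrite /= /lines_cross_ratio; case: xgetP => [_ -> [k [o [v [t1 [t2 [t3 [t4]]]]]]]|];
  last by rewrite eqxx.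
move=> [kov [e1 e2] [e3 e4] ->] a_neq0 r_neq0.
have D : bracket k o v != 0 := free3_bracket_neq0 _ _ _ kov.
have t12 : t1 - t2 != 0 by apply: contraNneq r_neq0 => t12; rewrite /chi t12 !mul0r.
(* The centre [k] of the chosen coordinates must be compared with [a]. Since [t1] and [t2] differ,
   the first two lines are distinct and meet only in the point of [k]; both contain [a]. *)
have [c ac] : exists c, a = c *: k.
  have al p : a \in line <[a]> <[p]> 
    by apply/in_line; exists 1, 0; rewrite scale1r scale0r addr0.
  have := al p1; rewrite e1 => /in_line[x [z az]].
  have := al p2; rewrite e2 => /in_line[x' [z' az']].
  have := congr1 (bracket k o) az'; rewrite {1}az !bracket_lin3.
  have := congr1 (bracket k v) az'; rewrite {1}az !bracket_lin3.
  have kaff u t : bracket k u (o + t *: v) = bracket k u o + t * bracket k u v.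
    by rewrite /bracket !mxE; ring.
  have [_ kok _] := bracketxx k o; have [_ kvk _] := bracketxx k v.
  have [_ _ koo] := bracketxx o k; have [_ _ kvv] := bracketxx v k.
  rewrite !kaff kok kvk koo kvv !mulr0 !add0r !addr0.
  have -> : bracket k v o = - bracket k o v by rewrite /bracket; ring.
  move=> /(mulIf (_ : - _ != 0)) zz.
  have {}zz : z = z' by apply: zz; rewrite oppr_eq0.
  rewrite -zz !mulrA => /(mulIf D)/eqP; rewrite -subr_eq0 -mulrBr mulf_eq0.
  rewrite (negPf t12) orbF => /eqP z0; exists x.
  by rewrite az z0 scale0r addr0.
have c_neq0 : c != 0 by apply: contraNneq a_neq0 => c0; rewrite ac c0 scale0r.
have Da : bracket a o v != 0.
  have -> : bracket a o v = c * bracket k o v by rewrite ac /bracket !mxE; ring.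
  by rewrite mulf_neq0.
(* The multiple of [a] disappears in every bracket with [a], so only the scaling [d] remains and
   [chi_bracket] applies. *)
have lc t p : line <[a]> <[p]> = line <[k]> <[o + t *: v]> ->
    exists2 d, d != 0 & exists x, o + t *: v = x *: a + d *: p.
  move=> e; have : o + t *: v \in line <[a]> <[p]>.
    by rewrite e; apply/in_line; exists 0, 1; rewrite scale1r scale0r add0r.
  move=> /in_line[x [d od]]; exists d; last by exists x.
  apply: contraNneq Da => d0; move: od; rewrite d0 scale0r addr0 => od.
  have := congr1 (fun u => bracket a u v) od.
  have -> : bracket a (o + t *: v) v = bracket a o v by rewrite /bracket !mxE; ring.
  by move=> ->; rewrite /bracket !mxE; apply/eqP; ring.
have [c1 c1n [x1 o1]] := lc _ _ e1.
have [c2 c2n [x2 o2]] := lc _ _ e2.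
have [c3 c3n [x3 o3]] := lc _ _ e3.
have [c4 c4n [x4 o4]] := lc _ _ e4.
have brZ (d d' x x' : R) p p' :
    bracket a (x *: a + d *: p) (x' *: a + d' *: p') = d * d' * bracket a p p'.
  by rewrite /bracket !mxE; ring.
by apply: (chi_bracket _ o v _ _ _ _ c1 c2 c3 c4); rewrite // ?o1 ?o2 ?o3 ?o4 brZ.
Qed.

(** The four points of the line through [p] and [q] are viewed from [r]; a three-term relation
    sharing [s] then turns the bracket of the two intersection points into a monomial. *)
Lemma line_inter_cross_ratio p q r s u :
  points_cross_ratio <[p]> <[q]> (inter (line <[r]> <[s]>) (line <[p]> <[q]>))
    (inter (line <[s]> <[u]>) (line <[p]> <[q]>)) != 0 ->
  bracket p q r != 0 -> bracket p r s != 0 -> bracket q s u != 0 ->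
  points_cross_ratio <[p]> <[q]> (inter (line <[r]> <[s]>) (line <[p]> <[q]>))
    (inter (line <[s]> <[u]>) (line <[p]> <[q]>))
  = (bracket p q s * bracket r s u) / (bracket p r s * bracket q s u).
Proof.
move=> + pqr prs qsu; rewrite /inter 2!(capvC (line _ _) (line <[p]> _)).
rewrite -!/(inter _ _) !inter_line ?prs ?qsu ?orbT //; try by exists r.
move=> x_neq0; rewrite (points_cross_ratioE r) //; last by rewrite bracket_cycle.
rewrite /bracket_chi -!scaleNr !bracket_lin2 !bracket_lin3.
have [_ _ rpp] := bracketxx p r; have [_ _ rqq] := bracketxx q r.
rewrite rpp rqq (bracket_cycle r p q) (_ : bracket r q p = - bracket p q r);
  last by rewrite /bracket; ring.
have e : bracket p q s * bracket r s u
    = bracket p r s * bracket q s u - bracket q r s * bracket p s u.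
  by rewrite /bracket; ring.
by rewrite e; field; rewrite ?pqr ?prs ?qsu.
Qed.

(** Seen from [q], every bracket is a multiple of [bracket q r s], which cancels. *)
Lemma side_cross_ratio p q r s u v :
  points_cross_ratio (inter (line <[p]> <[q]>) (line <[r]> <[s]>)) <[r]> <[s]>
    (inter (line <[u]> <[v]>) (line <[r]> <[s]>)) != 0 ->
  bracket p q r != 0 -> bracket p q s != 0 -> bracket q r s != 0 ->
  bracket r u v != 0 ->
  points_cross_ratio (inter (line <[p]> <[q]>) (line <[r]> <[s]>)) <[r]> <[s]>
    (inter (line <[u]> <[v]>) (line <[r]> <[s]>))
  = (bracket p q r * bracket s u v) / (bracket p q s * bracket r u v).
Proof.
move=> + pqr pqs qrs ruv; rewrite /inter 2!(capvC _ (line <[r]> _)).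
have rpq : bracket r p q = bracket p q r by rewrite bracket_cycle.
have spq : bracket s p q = bracket p q s by rewrite bracket_cycle.
rewrite -!/(inter _ _) !inter_line ?ruv ?rpq ?spq ?pqr //;
  try by exists q; rewrite -bracket_cycle.
move=> x_neq0; rewrite (points_cross_ratioE q) //.
  rewrite /bracket_chi -!scaleNr !bracket_lin2 !bracket_lin3.
  have [_ _ qrr] := bracketxx r q; have [_ _ qss] := bracketxx s q.
  rewrite qrr qss (_ : bracket q s r = - bracket q r s);
    last by rewrite /bracket; ring.
  by field; rewrite ?pqr ?pqs ?qrs ?ruv.
rewrite -!scaleNr !bracket_lin2; have [_ _ ->] := bracketxx r q.
by rewrite mulr0 addr0 mulf_neq0 // (_ : bracket q s r = - bracket q r s)
  ?oppr_eq0 // /bracket; ring.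
Qed.


(** * Coordinates of a polygon and of its pentagram image *)

(* Collects the literals of an index [j + c + d]. *)
Ltac norm_index :=
  repeat match goal with
  | |- context [?j + ?c + ?d] =>
    is_var j;
    lazymatch type of j with
    | int => idtac | Algebra.BaseAddMagma.sort _ => idtac end;
    let e := eval compute in (c + d : int) in
    lazymatch e with
    | Posz 0 => rewrite (_ : j + c + d = j); last by lia
    | Posz ?n => rewrite (_ : j + c + d = j + n%:R); last by lia
    | Negz ?n => rewrite (_ : j + c + d = j - n.+1%:R); last by lia
    end
  end.

Implicit Types (A : polygon R) (a : int -> 'rV[R]_3) (j : int).

(* With the doubled indices of [polygon], these are the determinants of the
   vertices (i, i+1, i+2), (i, i+1, i+3), (i, i+2, i+3) and (i, i+2, i+4),
   where i = d/2. *)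
Definition br012 a (d : int) := bracket (a d) (a (d + 2)) (a (d + 4)).
Definition br013 a (d : int) := bracket (a d) (a (d + 2)) (a (d + 6)).
Definition br023 a (d : int) := bracket (a d) (a (d + 4)) (a (d + 6)).
Definition br024 a (d : int) := bracket (a d) (a (d + 4)) (a (d + 8)).

Definition lifts A a : Prop :=
  forall d : int, is_index A d -> a d != 0 /\ vertex A d = <[a d]>%VS.

Definition nonsingular A a : Prop :=
  forall d : int, is_index A d ->
    [/\ br012 a d != 0, br013 a d != 0 & br023 a d != 0].

Lemma ycoord_index A a j : lifts A a -> is_index A j -> ycoord A j != 0 ->
  ycoord A j = - (br023 a (j - 4) * br013 a (j - 2))
    / (br012 a (j - 4) * br012 a j).
Proof.
move=> la ij; rewrite /ycoord ij.
have [aj -> ] := la _ ij.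
have [|_ ->] := la (j - 4); first by move: ij; rewrite /is_index; lia.
have [|_ ->] := la (j - 2); first by move: ij; rewrite /is_index; lia.
have [|_ ->] := la (j + 2); first by move: ij; rewrite /is_index; lia.
have [|_ ->] := la (j + 4); first by move: ij; rewrite /is_index; lia.
rewrite oppr_eq0 invr_eq0 => y_neq0; rewrite lines_cross_ratioE // /bracket_chi.
rewrite invf_div /br023 /br013 /br012; norm_index.
rewrite -(bracket_cycle (a j) (a (j - 4)) (a (j - 2))).
by rewrite (bracket_swap (a (j - 4)) (a j))
  (bracket_swap (a (j - 2)) (a j)) mulrNN mulNr.
Qed.

(** At an index, [ycoord] is a monomial in these determinants, some in the denominator. As division
    by zero gives 0, a nonzero value makes each of them nonzero. *)
Lemma nonsingular_ycoord A a :
  lifts A a -> (forall j, ycoord A j != 0) -> nonsingular A a.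
Proof.
move=> la y_neq0 d id.
have yE j : is_index A j ->
    [/\ br012 a j != 0, br013 a (j - 2) != 0 & br023 a (j - 4) != 0].
  move=> ij; have := y_neq0 j; rewrite (ycoord_index _ _ _ la) //.
  by rewrite !(mulf_eq0, oppr_eq0, invr_eq0, negb_or) => /andP[/andP[-> ->] /andP[]].
have [-> _ _] := yE _ id; split=> //.
  have [|_ ] := yE (d + 2); first by move: id; rewrite /is_index; lia.
  by norm_index.
have [|_ _] := yE (d + 4); first by move: id; rewrite /is_index; lia.
by norm_index.
Qed.

Lemma ycoord_nonindex A a j :
  lifts A a -> nonsingular A a -> ~~ is_index A j -> ycoord A j != 0 ->
  ycoord A j = - (br012 a (j - 5) * br012 a (j + 1))
    / (br013 a (j - 5) * br023 a (j - 1)).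
Proof.
move=> la ns ij; rewrite /ycoord (negPf ij); norm_index.
have [|_ ->] := la (j - 5); first by move: ij; rewrite /is_index; lia.
have [|_ ->] := la (j - 3); first by move: ij; rewrite /is_index; lia.
have [|_ ->] := la (j - 1); first by move: ij; rewrite /is_index; lia.
have [|_ ->] := la (j + 1); first by move: ij; rewrite /is_index; lia.
have [|_ ->] := la (j + 3); first by move: ij; rewrite /is_index; lia.
have [|_ ->] := la (j + 5); first by move: ij; rewrite /is_index; lia.
have [|] := ns (j - 5); first by move: ij; rewrite /is_index; lia.
have [|] := ns (j - 3); first by move: ij; rewrite /is_index; lia.
have [|] := ns (j - 1); first by move: ij; rewrite /is_index; lia.
rewrite /br012 /br013 /br023; norm_index.
move=> b1 b2 b3 b4 b5 b6 b7 b8 b9.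
by rewrite oppr_eq0 => y_neq0; rewrite side_cross_ratio // mulNr.
Qed.

Lemma xcoord_index A a j :
  lifts A a -> nonsingular A a -> is_index A j -> xcoord A j != 0 ->
  xcoord A j = br013 a (j - 4) * br012 a j / (br023 a (j - 4) * br023 a (j - 2)).
Proof.
move=> la ns ij; rewrite /xcoord ij.
have [|_ ->] := la (j - 4); first by move: ij; rewrite /is_index; lia.
have [|_ ->] := la (j - 2); first by move: ij; rewrite /is_index; lia.
have [|_ ->] := la j; first by move: ij; rewrite /is_index; lia.
have [|_ ->] := la (j + 2); first by move: ij; rewrite /is_index; lia.
have [|_ ->] := la (j + 4); first by move: ij; rewrite /is_index; lia.
have [|] := ns (j - 4); first by move: ij; rewrite /is_index; lia.
have [|] := ns (j - 2); first by move: ij; rewrite /is_index; lia.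
rewrite /br012 /br013 /br023; norm_index.
move=> b1 b2 b3 b4 b5 b6 x_neq0.
by rewrite line_inter_cross_ratio.
Qed.

Lemma xcoord_nonindex A a j :
  lifts A a -> nonsingular A a -> ~~ is_index A j -> xcoord A j != 0 ->
  xcoord A j = br023 a (j - 3) * br012 a (j - 5)
    / (br013 a (j - 3) * br013 a (j - 5)).
Proof.
move=> la ns ij; rewrite /xcoord (negPf ij); norm_index.
have [|_ ->] := la (j - 5); first by move: ij; rewrite /is_index; lia.
have [|_ ->] := la (j - 3); first by move: ij; rewrite /is_index; lia.
have [|_ ->] := la (j - 1); first by move: ij; rewrite /is_index; lia.
have [|_ ->] := la (j + 1); first by move: ij; rewrite /is_index; lia.
have [|_ ->] := la (j + 3); first by move: ij; rewrite /is_index; lia.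
have [|] := ns (j - 5); first by move: ij; rewrite /is_index; lia.
have [|] := ns (j - 3); first by move: ij; rewrite /is_index; lia.
have [|] := ns (j - 1); first by move: ij; rewrite /is_index; lia.
rewrite /br012 /br013 /br023; norm_index.
(* The definition at a non-index reads the vertices backwards. Reversing the four brackets of the
   formula changes four signs, which cancel. *)
have rev p q r : bracket p q r = - bracket r q p :> R by rewrite /bracket; ring.
move=> b1 b2 b3 b4 b5 b6 b7 b8 b9 x_neq0.
rewrite line_inter_cross_ratio //; try by rewrite rev oppr_eq0.
rewrite (rev (a (j - 3))) (rev (a (j - 5))) [bracket (a (j - 3)) _ (a (j + 3))]rev.
rewrite [bracket (a (j - 5)) _ (a (j + 1))]rev.
by rewrite !mulrNN.
Qed.

(** The three-term relation for brackets sharing [a j] collapses the sum to one monomial, in which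
    [br024] appears. *)
Lemma one_add_ycoord A a j : lifts A a -> nonsingular A a ->
  is_index A j -> ycoord A j != 0 ->
  1 + ycoord A j = - (br024 a (j - 4) * br012 a (j - 2))
    / (br012 a (j - 4) * br012 a j).
Proof.
move=> la ns ij yj; rewrite (ycoord_index _ _ _ la) //.
have [|n1 _ _] := ns (j - 4); first by move: ij; rewrite /is_index; lia.
have [n2 _ _] := ns _ ij.
have e : br023 a (j - 4) * br013 a (j - 2)
    = br012 a (j - 4) * br012 a j + br024 a (j - 4) * br012 a (j - 2).
  by rewrite /br012 /br013 /br023 /br024; norm_index; rewrite -bracket_plucker.
by rewrite e; field; rewrite n1 n2.
Qed.

(** The vector given by [inter_line] for the two short diagonals that meet in this vertex. This
    scaling is polynomial in the lifts and makes the determinants of the image monomials. *)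
Definition pentagram_lift a (d : int) : 'rV[R]_3 :=
  br013 a (d - 3) *: a (d + 1) + br012 a (d - 1) *: a (d - 3).

Lemma pentagram_liftE a (d : int) :
  pentagram_lift a d = br023 a (d - 3) *: a (d - 1) + br012 a (d - 3) *: a (d + 3).
Proof.
rewrite /pentagram_lift /br012 /br013 /br023; norm_index.
by rewrite addrC bracket_cramer.
Qed.

Lemma lifts_pentagram A a : lifts A a -> nonsingular A a ->
  lifts (pentagram A) (pentagram_lift a).
Proof.
move=> la ns d id.
have iA (c : int) : odd `|c|%N -> is_index A (d + c).
  by move: id; rewrite /is_index /=; lia.
have [|n012 n013 _] := ns (d - 3); first exact: iA.
have [|n012' _ _] := ns (d - 1); first exact: iA.
split.
  (* This bracket is [br013 a (d - 3) * br012 a (d - 3)], so the lift is not the zero vector. *)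
  have : bracket (a (d - 3)) (a (d - 1)) (pentagram_lift a d) != 0.
    rewrite /pentagram_lift bracket_lin3.
    have [_ -> _] := bracketxx (a (d - 3)) (a (d - 1)).
    rewrite mulr0 addr0 mulf_neq0 //.
    by move: n012; rewrite /br012; norm_index.
  by apply: contraNneq => ->; rewrite /bracket !mxE; apply/eqP; ring.
have [|_ e1] := la (d - 3); first exact: iA.
have [|_ e2] := la (d - 1); first exact: iA.
have [|_ e3] := la (d + 1); first exact: iA.
have [|_ e4] := la (d + 3); first exact: iA.
rewrite /= e1 e2 e3 e4.
move: n012 n013 n012'; rewrite /pentagram_lift /br012 /br013; norm_index => n1 n2 n3.
rewrite inter_line ?n2 //.
  by rewrite [bracket (a (d + 1)) _ _]bracket_swap scaleNr opprK.
exists (a (d - 1)).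
have -> : bracket (a (d - 3)) (a (d + 1)) (a (d - 1))
    = - bracket (a (d - 3)) (a (d - 1)) (a (d + 1)).
  by rewrite /bracket; ring.
by rewrite oppr_eq0.
Qed.

(* Two consecutive points of the pentagram lie on a common short diagonal. *)
Lemma bracket_pentagram_pair a (d : int) u :
  bracket (pentagram_lift a d) (pentagram_lift a (d + 2)) u
  = br024 a (d - 3) * br012 a (d - 1) * bracket (a (d - 1)) (a (d + 3)) u.
Proof.
rewrite pentagram_liftE /pentagram_lift; norm_index.
rewrite !bracket_lin1 !bracket_lin2.
have [-> _ _] := bracketxx (a (d + 3)) u; have [-> _ _] := bracketxx (a (d - 1)) u.
rewrite (bracket_swap (a (d - 1)) (a (d + 3))).
(* The relation behind [one_add_ycoord], now sharing [a (d + 1)]. *)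
have e : br023 a (d - 3) * br013 a (d - 1)
    = br012 a (d - 3) * br012 a (d + 1) + br024 a (d - 3) * br012 a (d - 1).
  by rewrite /br012 /br013 /br023 /br024; norm_index; rewrite -bracket_plucker.
by transitivity ((br023 a (d - 3) * br013 a (d - 1)
    - br012 a (d - 3) * br012 a (d + 1))
   * bracket (a (d - 1)) (a (d + 3)) u); [ring | rewrite e; ring].
Qed.

(** The third point is expanded along the short diagonal sharing an endpoint with that of the pair,
    so a single term survives. The next two determinants are found likewise. *)
Lemma br012_pentagram a (d : int) : br012 (pentagram_lift a) d
  = br024 a (d - 3) * br012 a (d - 1) * br012 a (d + 1) * br024 a (d - 1).
Proof.
rewrite {1}/br012 bracket_pentagram_pair pentagram_liftE bracket_lin3; norm_index.
have [_ _ ->] := bracketxx (a (d + 3)) (a (d - 1)).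
by rewrite /br024; norm_index; ring.
Qed.

Lemma br013_pentagram a (d : int) : br013 (pentagram_lift a) d
  = br024 a (d - 3) * br012 a (d - 1) * br024 a (d - 1) * br013 a (d + 3).
Proof.
rewrite {1}/br013 bracket_pentagram_pair /pentagram_lift bracket_lin3; norm_index.
have [_ _ ->] := bracketxx (a (d + 3)) (a (d - 1)).
by rewrite /br024; norm_index; ring.
Qed.

Lemma br023_pentagram a (d : int) : br023 (pentagram_lift a) d
  = br024 a (d + 1) * br012 a (d + 3) * br024 a (d - 1) * br023 a (d - 3).
Proof.
rewrite {1}/br023 bracket_cycle (_ : d + 6 = d + 4 + 2); last by lia.
rewrite bracket_pentagram_pair pentagram_liftE bracket_lin3; norm_index.
have [_ -> _] := bracketxx (a (d + 3)) (a (d + 7)).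
by rewrite -(bracket_cycle (a (d - 1))) /br024; norm_index; ring.
Qed.


Lemma is_index_pentagram A j : is_index (pentagram A) j = ~~ is_index A j.
Proof. by rewrite /is_index /=; case: (odd _); case: half_indexed. Qed.

Lemma is_index_odd A j (c : int) : odd `|c|%N ->
  is_index A (j + c) = ~~ is_index A j.
Proof. by move=> oc; rewrite /is_index; case: half_indexed; lia. Qed.

Lemma is_index_even A j (c : int) : ~~ odd `|c|%N ->
  is_index A (j + c) = is_index A j.
Proof. by move=> oc; rewrite /is_index; case: half_indexed; lia. Qed.

(** * The effect of one pentagram step on the coordinates *)

Section OneStep.
Variables (A : polygon R) (a : int -> 'rV[R]_3).
Let B := pentagram A.
Hypothesis la : lifts A a.
Hypothesis xA : forall j, xcoord A j != 0.
Hypothesis yA : forall j, ycoord A j != 0.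
Hypothesis xB : forall j, xcoord B j != 0.
Hypothesis yB : forall j, ycoord B j != 0.

Let nsA : nonsingular A a. Proof. exact: nonsingular_ycoord. Qed.
Let lB : lifts B (pentagram_lift a). Proof. exact: lifts_pentagram. Qed.
Let nsB : nonsingular B (pentagram_lift a). Proof. exact: nonsingular_ycoord. Qed.

Let n012 j : is_index A j -> br012 a j != 0. Proof. by case/nsA. Qed.
Let n013 j : is_index A j -> br013 a j != 0. Proof. by case/nsA. Qed.
Let n023 j : is_index A j -> br023 a j != 0. Proof. by case/nsA. Qed.

(* [br024 a] is a factor of [br012] of the pentagram image, which is nonzero. *)
Let n024 j : is_index A j -> br024 a j != 0.
Proof.
move=> ij; have [|+ _ _] := nsB (j + 1).
  by rewrite is_index_pentagram is_index_odd ?negbK.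
by rewrite br012_pentagram; norm_index; rewrite !mulf_eq0 !negb_or => /andP[].
Qed.

Let xe j ij := xcoord_index _ _ j la nsA ij (xA j).
Let xo j ij := xcoord_nonindex _ _ j la nsA ij (xA j).
Let ye j ij := ycoord_index _ _ j la ij (yA j).
Let yo j ij := ycoord_nonindex _ _ j la nsA ij (yA j).
Let y1 j ij := one_add_ycoord _ _ j la nsA ij (yA j).

Lemma one_add_ycoord_neq0 j : is_index A j -> 1 + ycoord A j != 0.
Proof.
move=> ij; rewrite (one_add_ycoord _ _ _ la) //.
by rewrite !mulf_neq0 ?oppr_eq0 ?invr_eq0 ?mulf_neq0 ?n024 ?n012 ?is_index_even.
Qed.

(** Here and in the next three lemmas, all coordinates of [A] and [B] become monomials in nonzero
    determinants of [A], and the identity is a cancellation. *)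
Lemma ycoord_pentagram_index j : ~~ is_index A j ->
  ycoord B j = ycoord A (j - 3) * ycoord A j * ycoord A (j + 3)
    * ((1 + ycoord A (j - 1)) * (1 + ycoord A (j + 1)))
    / ((1 + ycoord A (j - 3)) * (1 + ycoord A (j + 3))).
Proof.
move=> ij; have iB : is_index B j by rewrite is_index_pentagram.
have iA (c : int) : odd `|c| -> is_index A (j + c).
  by move=> oc; rewrite is_index_odd.
rewrite (ycoord_index _ _ _ lB iB (yB j)).
rewrite (y1 (j - 3)) ?iA // (y1 (j - 1)) ?iA //.
rewrite (y1 (j + 1)) ?iA // (y1 (j + 3)) ?iA //.
rewrite (yo j) //.
rewrite (ye (j - 3)) ?iA //.
rewrite (ye (j + 3)) ?iA //.
rewrite !br012_pentagram !br013_pentagram !br023_pentagram; norm_index.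
by field; rewrite ?n012 ?n013 ?n023 ?n024 ?iA.
Qed.

Lemma ycoord_pentagram_nonindex j : is_index A j -> ycoord B j = (ycoord A j)^-1.
Proof.
move=> ij; have iB : ~~ is_index B j by rewrite is_index_pentagram negbK.
rewrite (ycoord_nonindex _ _ _ lB nsB iB (yB j)) (ye j) //.
rewrite !br012_pentagram !br013_pentagram !br023_pentagram; norm_index.
by field; rewrite ?n012 ?n013 ?n023 ?n024 ?is_index_even.
Qed.

Lemma xcoord_pentagram_index j : ~~ is_index A j ->
  xcoord B j = xcoord A (j - 3) * (ycoord A (j - 2) * ycoord A (j + 1))
    * ((1 + ycoord A (j - 3)) / (1 + ycoord A (j + 1))).
Proof.
move=> ij; have iB : is_index B j by rewrite is_index_pentagram.
have iA (c : int) : odd `|c| -> is_index A (j + c).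
  by move=> oc; rewrite is_index_odd.
rewrite (xcoord_index _ _ _ lB nsB iB (xB j)).
rewrite (y1 (j - 3)) ?iA // (y1 (j + 1)) ?iA //.
rewrite (xe (j - 3)) ?iA //.
rewrite (ye (j + 1)) ?iA //.
rewrite (yo (j - 2)) ?is_index_even //.
rewrite !br012_pentagram !br013_pentagram !br023_pentagram; norm_index.
by field; rewrite ?n012 ?n013 ?n023 ?n024 ?iA.
Qed.

Lemma xcoord_pentagram_nonindex j : is_index A j ->
  xcoord B j = xcoord A (j + 3) * (ycoord A (j - 2) * ycoord A (j + 1))
    * ((1 + ycoord A (j + 2)) / (1 + ycoord A (j - 2))).
Proof.
move=> ij; have iB : ~~ is_index B j by rewrite is_index_pentagram negbK.
have iA (c : int) : ~~ odd `|c| -> is_index A (j + c).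
  by move=> oc; rewrite is_index_even.
rewrite (xcoord_nonindex _ _ _ lB nsB iB (xB j)).
rewrite (y1 (j + 2)) ?iA // (y1 (j - 2)) ?iA //.
rewrite (xo (j + 3)) ?is_index_odd ?negbK //.
rewrite (ye (j - 2)) ?iA //.
rewrite (yo (j + 1)) ?is_index_odd ?negbK //.
rewrite !br012_pentagram !br013_pentagram !br023_pentagram; norm_index.
by field; rewrite ?n012 ?n013 ?n023 ?n024 ?iA.
Qed.

End OneStep.

Lemma lifts_exist A : (forall d : int, is_index A d -> \dim (vertex A d) = 1%N) ->
  exists a, lifts A a.
Proof.
move=> dim1; exists (fun d : int => vpick (vertex A d)) => d /dim1 dimd.
have v_neq0 : vpick (vertex A d) != 0 by rewrite vpick0 -dimv_eq0 dimd.
split=> //; apply/esym/eqP; rewrite eqEdim dimd dim_vline v_neq0 leqnn andbT.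
by rewrite -memvE memv_pick.
Qed.

End Bracket.

Theorem theorem4p2 (R : realType) (n : nat) (A : polygon R)
    (n_gt0 : (0 < n)%N) (A_twisted : twisted_ngon n A)
    (A_integer : half_indexed A = false) (A_generic : generic A)
    (j : int) (k : nat) :
  let x := xcoord A in
  let y := ycoord A in
  xcoord (iter k (@pentagram R) A) j =
    if ~~ odd (absz (j + k%:Z)) then
      x (j - 3 * k%:Z)
      * (\prod_(0 <= i < 2 * k) y (j + 1 + 3 * (i%:Z - k%:Z)))
      * ((F y (j + 2) (k%:Z - 1) * F y (j - 3) k%:Z)
         / (F y (j - 2) (k%:Z - 1) * F y (j + 1) k%:Z))
    else
      x (j + 3 * k%:Z)
      * (\prod_(0 <= i < 2 * k) y (j + 1 + 3 * (i%:Z - k%:Z)))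
      * ((F y (j - 3) (k%:Z - 1) * F y (j + 2) k%:Z)
         / (F y (j + 1) (k%:Z - 1) * F y (j - 2) k%:Z)).
Proof.
move=> x y.
(* Each step passes to the other coset of indices, so the parity of [m] decides which doubled
   indices are meaningful. *)
have idx m d : is_index (iter m (@pentagram R) A) d = ~~ odd (absz (d + m%:Z)).
  have half : half_indexed (iter m (@pentagram R) A) = odd m.
    by elim: m => //= m ->.
  by rewrite /is_index half; lia.
(* Lifts are chosen afresh at each level: the one-step formulas mention only coordinates, so no
   compatibility between levels is required. *)
have lift m : exists a, lifts R (iter m (@pentagram R) A) a.
  by apply: lifts_exist => d id; have [/(_ d id)[]] := A_generic m.
have xm m d : xcoord (iter m (@pentagram R) A) d != 0.
  by have [_ /(_ d)[]] := A_generic m.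
have ym m d : ycoord (iter m (@pentagram R) A) d != 0.
  by have [_ /(_ d)[]] := A_generic m.
pose X m := xcoord (iter m (@pentagram R) A).
pose Y m := ycoord (iter m (@pentagram R) A).
have [||||||Xe Xo] := @X_closed_form R y (ym 0) X Y _ _ _ _ _ _ k => //.
- move=> m d; rewrite -idx => id; have [a la] := lift m.
  by apply: (one_add_ycoord_neq0 _ _ _ la (ym m) (ym m.+1)).
- move=> m d; rewrite -[odd _]negbK -idx => id; have [a la] := lift m.
  by apply: (ycoord_pentagram_index _ _ _ la (ym m) (ym m.+1)).
- move=> m d; rewrite -idx => id; have [a la] := lift m.
  by apply: (ycoord_pentagram_nonindex _ _ _ la (ym m) (ym m.+1)).
- move=> m d; rewrite -[odd _]negbK -idx => id; have [a la] := lift m.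
  by apply: (xcoord_pentagram_index _ _ _ la (xm m) (ym m) (xm m.+1) (ym m.+1)).
- move=> m d; rewrite -idx => id; have [a la] := lift m.
  by apply: (xcoord_pentagram_nonindex _ _ _ la (xm m) (ym m) (xm m.+1) (ym m.+1)).
have prodE : \prod_(0 <= i < 2 * k) y (j + 1 + 3 * (i%:Z - k%:Z))
    = even_prod R y k (j + 1).
  by rewrite /even_prod /prog_prod; apply: eq_bigr => i _; congr y; lia.
(* For [k = 0] the index is $-1$, and the shift by one lands on [Fshift y 0]. *)
have F1 d : F y d (k%:Z - 1) = Fshift y k d by rewrite /F subrK.
have F0 d : F y d k%:Z = Fshift y k.+1 d by rewrite /F -PoszD addn1.
rewrite prodE !F0 !F1; case: ifP => [/Xe //|/negbFE/Xo //].
Qed.
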